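(* Let $A$ be a unital ring, $n\geq 3$ and let $S_n$ be the closed disk with $n$ punctures on the boundary, numbered $1,\dots,n$ cyclically. Let $i,j\in\{1,\dots,n\}$, $i\neq j$, and let $\gamma_{i,j}$ be the arc from $j$ to $i$. Then for every ideal triangulation $\mathcal{T}$ of $S_n$ and every decorated twisted $\mathrm{GL}_2(A)$-local system $\mathcal{L}$ on $S_n$ that is both $\mathcal{T}$-transverse and $(i,j)$-transverse, the $\mathcal{A}$-coordinate $a_{\gamma_{i,j}}$ is a non-commutative Laurent polynomial in the $\mathcal{A}$-coordinates $(a_\gamma)_{\gamma\in\mathcal{T}}$ associated with $\mathcal{T}$.
   Context: $S_n=\bar S\setminus P$ where $\bar S$ is an oriented closed disk and $P\subset\partial\bar S$ consists of $n$ points. An ideal triangulation $\mathcal{T}$ is a triangulation of $\bar S$ with vertex set $P$; its edges (including the boundary edges) are considered with both orientations, $\bar\gamma$ denoting $\gamma$ reversed. $T'S$ is the bundle of nonzero tangent vectors modulo positive scaling. For each puncture $p$ fix near $p$ a simple smooth arc $\beta_p$ joining the two boundary segments adjacent to $p$, with $p$ on its right, and let $T'\beta_p=(\beta_p,\dot\beta_p)\subset T'S$. Every oriented arc $\gamma$ from $p$ to $q$ is represented by a smooth arc bent so that it meets $\beta_p$ and $\beta_q$ exactly once each, with velocity tangent to and in the same direction as $\dot\beta_p$, resp. $\dot\beta_q$; thus its lift $T'\gamma=(\gamma,\dot\gamma)$ meets $T'\beta_p$ and $T'\beta_q$. A twisted $\mathrm{GL}_2(A)$-local system on $S$ is a flat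 $A^2$-bundle (right $A$-modules) over $T'S$ with holonomy $-\mathrm{Id}$ around the circle fibers of $T'S\to S$. An element $x\in A^2$ is regular if it belongs to a basis $(x,y)$ of $A^2$; $xA$ and $yA$ are transverse if $(x,y)$ can be chosen to be a basis. A decoration consists, for each $p\in P$, of a parallel section $v_p$ of $\mathcal{L}$ along $T'\beta_p$ with regular values, spanning a line subbundle $L_p=v_pA$, and a parallel section $w_p$ of $\mathcal{L}/L_p$ along $T'\beta_p$ generating this rank-one quotient. $\mathcal{L}$ is $(i,j)$-transverse if $L_i$ and $L_j$ are transverse after parallel transport along $T'\gamma_{i,j}$, and $\mathcal{T}$-transverse if this holds for the two ends of every edge of $\mathcal{T}$. For an arc $\gamma$ from $p$ to $q$ along which $L_p,L_q$ are transverse, trivialize $\mathcal{L}$ over $T'\gamma$ by parallel transport; the projection $L_p=\mathrm{Span}(v_p)\to\mathcal{L}/L_q=\mathrm{Span}(w_q)$ is an isomorphism, and the $\mathcal{A}$-coordinate $a_\gamma\in A^\times$ is its $1\times1$ matrix, i.e. $v_p\mapsto w_qa_\gamma$. A non-commutative Laurent polynomial in $(a_\gamma)_{\gamma\in\mathcal{T}}$ is a finite $\mathbb{Z}$-linear combination of (non-commutative) monomials in the elements $a_\gamma$ and $a_\gamma^{-1}$, $\gamma\in\mathcal{T}$. *)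

(* Defs.v *)
From HB Require Import structures.
From mathcomp Require Import all_boot all_order all_algebra.
From mathcomp Require Import all_classical all_reals all_analysis.

Set Implicit Arguments.
Unset Strict Implicit.
Unset Printing Implicit Defensive.

Import Order.TTheory GRing.Theory Num.Theory.
Import numFieldNormedType.Exports.

Local Open Scope classical_set_scope.
Local Open Scope ring_scope.

(* Right A-modules are left modules over the converse ring A^c, so that
   (v *r a) *r b = v *r (a * b). *)
Definition rscale (A : pzRingType) (V : lmodType A^c) (v : V) (a : A) : V :=
  (a : A^c) *: v.
Notation "v *r a" := (rscale v a) (at level 40, left associativity).

Section RightModules.
Context (A : pzRingType) (V : lmodType A^c).

Definition is_basis2 (x y : V) : Prop :=
  forall z : V, exists! ab : A * A, z = x *r ab.1 + y *r ab.2.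

Definition is_regular (x : V) : Prop := exists y : V, is_basis2 x y.

Definition rline (x : V) : set V := [set z | exists a : A, z = x *r a].

Definition transverse_lines (l m : set V) : Prop :=
  exists x y : V, [/\ rline x = l, rline y = m & is_basis2 x y].

End RightModules.

(* A flat A^2-bundle over the subspace D of X: an atlas of local frames, i.e.
   fibrewise isomorphisms A^2 -> fib x, with locally constant transition
   matrices. Only the fibres over D are meaningful. *)
Record flat_bundle2 (A : pzRingType) (X : topologicalType) (D : set X) := {
  fib :> X -> lmodType A^c ;
  chart : Type ;
  chart_dom : chart -> set X ;
  frame1 : chart -> forall x : X, fib x ;
  frame2 : chart -> forall x : X, fib x ;
  chart_open : forall i x, D x -> chart_dom i x ->
    \forall y \near within D (nbhs x), chart_dom i y ;
  chart_cover : forall x, D x -> exists i, chart_dom i x ;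
  frame_basis : forall i x, D x -> chart_dom i x ->
    is_basis2 (frame1 i x) (frame2 i x) ;
  frame_flat : forall i j x, D x -> chart_dom i x -> chart_dom j x ->
    exists g11 g21 g12 g22 : A, \forall y \near within D (nbhs x),
      frame1 j y = frame1 i y *r g11 + frame2 i y *r g21 /\
      frame2 j y = frame1 i y *r g12 + frame2 i y *r g22
}.

Section Parallel.
Context (R : realType) (A : pzRingType) (X : topologicalType) (D : set X).
Context (B : flat_bundle2 A D).

Definition total_space := {x : X & B x}.

Definition in_fib (x : X) (z : B x) : total_space := existT (fun y : X => B y : Type) x z.

(* s is a parallel section of B along the path c restricted to [a, b]. Sections
   take values in the total space, so that sections along different paths can be
   compared at a common point of these paths. *)
Definition parallel (c : R -> X) (a b : R) (s : R -> total_space) : Prop :=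
  forall t0, a <= t0 <= b ->
  exists (i : chart B) (u1 u2 : A), chart_dom i (c t0) /\
    \forall t \near within `[a, b] (nbhs t0),
      s t = in_fib (frame1 i (c t) *r u1 + frame2 i (c t) *r u2).

(* For a parallel section v along c, the section w represents a parallel section
   of the quotient by the line subbundle v A: locally, the class of w modulo v A
   is the class of a parallel section. *)
Definition parallel_mod (c : R -> X) (a b : R)
    (v w : forall t : R, B (c t)) : Prop :=
  forall t0, a <= t0 <= b ->
  exists (i : chart B) (u1 u2 : A), chart_dom i (c t0) /\
    \forall t \near within `[a, b] (nbhs t0),
      rline (v t) (w t - (frame1 i (c t) *r u1 + frame2 i (c t) *r u2)).

End Parallel.
Arguments in_fib {A X D B} x z.

Section Plane.
Context (R : realType).

Definition plane := (R * R)%type.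

Definition sqnorm (x : plane) : R := x.1 ^+ 2 + x.2 ^+ 2.

Definition unit_vec (a : R) : plane := (cos a, sin a).

Definition direction (v : plane) : plane := (Num.sqrt (sqnorm v))^-1 *: v.

Definition velocity (c : R -> plane) (t : R) : plane :=
  (derive1 (fun s => (c s).1) t, derive1 (fun s => (c s).2) t).

(* A simple smooth arc parametrized by [0, 1]; smoothness up to the endpoints
   means that the parametrization extends smoothly to the real line. *)
Definition simple_smooth_arc (c : R -> plane) : Prop :=
  [/\ forall (k : nat) (t : R), derivable (derive1n k (fun s => (c s).1)) t 1 /\
        derivable (derive1n k (fun s => (c s).2)) t 1,
      forall t, 0 <= t <= 1 -> velocity c t <> (0, 0)
    & {in `[0, 1]%R &, injective c}].

(* T'c = (c, c'); a tangent direction, i.e. a nonzero vector modulo positive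
   scaling, is represented by the unit vector in its class. *)
Definition tangent_lift (c : R -> plane) (t : R) : plane * plane :=
  (c t, direction (velocity c t)).

End Plane.

(* The closed disk is the unit disk with the orientation of the plane; the
   punctures are numbered counterclockwise along its boundary. *)
Record punctures (R : realType) (n : nat) := {
  angle :> 'I_n -> R ;
  angle_incr : forall p q : 'I_n, (p < q)%N -> angle p < angle q ;
  angle_turn : forall p q : 'I_n, angle p < angle q + 2 * pi
}.

Section Disk.
Context (R : realType) (n : nat) (P : punctures R n).

Definition puncture (p : 'I_n) : plane R := unit_vec (P p).

Definition disk : set (plane R) :=
  [set x | sqnorm x <= 1 /\ forall p, x <> puncture p].

Definition dir_bundle : set (plane R * plane R) :=
  [set xu | disk xu.1 /\ sqnorm xu.2 = 1].

(* The arcs beta_p. The one at p runs, inside the disk, from the boundary segment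
   that precedes p (counterclockwise) to the one that follows p, so that p is on
   its right. Being close to the punctures, the arcs are pairwise disjoint and
   their endpoints come in the cyclic order of the punctures. *)
Record puncture_arcs := {
  beta :> 'I_n -> R -> plane R ;
  beta_from : 'I_n -> R ;
  beta_to : 'I_n -> R ;
  beta_arc : forall p, simple_smooth_arc (beta p) ;
  beta_start : forall p, beta p 0 = unit_vec (beta_from p) ;
  beta_end : forall p, beta p 1 = unit_vec (beta_to p) ;
  beta_inside : forall p t, 0 < t < 1 -> sqnorm (beta p t) < 1 ;
  beta_around : forall p, beta_from p < P p < beta_to p ;
  beta_incr : forall p q : 'I_n, (p < q)%N -> beta_to p < beta_from q ;
  beta_turn : forall p q : 'I_n, beta_to p < beta_from q + 2 * pi ;
  beta_disjoint : forall p q s t, p != q -> 0 <= s <= 1 -> 0 <= t <= 1 ->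
    beta p s <> beta q t
}.

(* A representative of the oriented arc from p to q: it meets beta_p only at the
   parameter exit_time, at the point of parameter exit_pos of beta_p, and there
   the two lifts to the bundle of directions agree; likewise for beta_q. *)
Record bent_arc (b : puncture_arcs) (p q : 'I_n) := {
  bent :> R -> plane R ;
  exit_time : R ;
  exit_pos : R ;
  entry_time : R ;
  entry_pos : R ;
  bent_arcP : simple_smooth_arc bent ;
  bent_start : bent 0 = puncture p ;
  bent_end : bent 1 = puncture q ;
  bent_disk : forall t, 0 < t < 1 -> disk (bent t) ;
  bent_times : [/\ 0 < exit_time, exit_time < entry_time & entry_time < 1] ;
  exit_posP : 0 <= exit_pos <= 1 ;
  entry_posP : 0 <= entry_pos <= 1 ;
  exit_tangent : tangent_lift bent exit_time = tangent_lift (b p) exit_pos ;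
  entry_tangent : tangent_lift bent entry_time = tangent_lift (b q) entry_pos ;
  exit_once : forall s t, 0 <= s <= 1 -> 0 <= t <= 1 ->
    bent t = b p s -> t = exit_time ;
  entry_once : forall s t, 0 <= s <= 1 -> 0 <= t <= 1 ->
    bent t = b q s -> t = entry_time
}.

Definition arc_system (b : puncture_arcs) : Type :=
  forall p q : 'I_n, p != q -> bent_arc b p q.

Record twisted_local_system (A : pzRingType) := {
  bundle :> flat_bundle2 A dir_bundle ;
  fiber_holonomy : forall (x : plane R) (a : R)
      (s : R -> total_space bundle) (z : bundle (x, unit_vec a)),
    disk x ->
    parallel (fun t => (x, unit_vec (a + t))) 0 (2 * pi) s ->
    s 0 = in_fib (x, unit_vec a) z ->
    s (2 * pi) = in_fib (x, unit_vec a) (- z)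
}.

(* deco_w p t represents the value of w_p in the quotient of the fibre by
   L_p = v_p A; the last condition says that this class is a basis of the
   quotient. *)
Record decoration (A : pzRingType) (b : puncture_arcs)
    (L : twisted_local_system A) := {
  deco_v : forall (p : 'I_n) (t : R), L (tangent_lift (b p) t) ;
  deco_w : forall (p : 'I_n) (t : R), L (tangent_lift (b p) t) ;
  deco_v_parallel : forall p,
    parallel (tangent_lift (b p)) 0 1 (fun t => in_fib _ (deco_v p t)) ;
  deco_v_regular : forall p t, 0 <= t <= 1 -> is_regular (deco_v p t) ;
  deco_w_parallel : forall p,
    parallel_mod (c := tangent_lift (b p)) 0 1 (deco_v p) (deco_w p) ;
  deco_w_basis : forall p t, 0 <= t <= 1 -> forall z : L (tangent_lift (b p) t),
    exists! a : A, rline (deco_v p t) (z - deco_w p t *r a)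
}.

Section Coordinates.
Context (A : pzRingType) (b : puncture_arcs) (L : twisted_local_system A).
Context (d : decoration b L) (p q : 'I_n) (g : bent_arc b p q).

(* Parallel transport along T'g carries v_p to the vector z over T'beta_q. *)
Definition transported_v (z : L (tangent_lift (b q) (entry_pos g))) : Prop :=
  exists s : R -> total_space L,
    [/\ parallel (tangent_lift g) (exit_time g) (entry_time g) s,
        s (exit_time g) = in_fib _ (deco_v d p (exit_pos g))
      & s (entry_time g) = in_fib _ z].

Definition transverse_along : Prop :=
  exists2 z, transported_v z &
    transverse_lines (rline z) (rline (deco_v d q (entry_pos g))).

(* v_p = w_q a modulo L_q *)
Definition is_A_coordinate (a : A) : Prop :=
  exists2 z, transported_v z &
    rline (deco_v d q (entry_pos g)) (z - deco_w d q (entry_pos g) *r a).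

(* The A-coordinate is the unique a such that is_A_coordinate a. *)
Definition A_coordinate : A := xget 0 [set a | is_A_coordinate a].

End Coordinates.

End Disk.

(* i, k, j are pairwise distinct and come in this counterclockwise order *)
Definition ccw (n : nat) (i k j : 'I_n) : bool :=
  [|| (i < k < j)%N, (k < j < i)%N | (j < i < k)%N].

(* Arcs between punctures of a disk are determined up to isotopy by their
   endpoints, so a triangulation is given by the relation T i j: {i, j} is an
   edge. The edges do not cross, they include the boundary edges, and the region
   adjacent to either side of an edge is a triangle unless the edge is a boundary
   edge and that side is outside the disk; the side of {i, j} considered in the
   last condition is the one with the vertices strictly between i and j. *)
Record ideal_triangulation (n : nat) := {
  edge :> rel 'I_n ;
  edge_irr : irreflexive edge ;
  edge_sym : symmetric edge ;
  edge_boundary : forall i : 'I_n, edge i (ordS i) ;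
  edge_noncrossing : forall i j k l : 'I_n,
    edge i j -> edge k l -> ~~ (ccw i k j && ccw j l i) ;
  edge_triangle : forall i j : 'I_n, edge i j -> j != ordS i ->
    exists k : 'I_n, [/\ ccw i k j, edge i k & edge k j]
}.

(* x is a finite Z-linear combination of monomials, i.e. products of finite
   sequences, in the elements of G and their inverses. *)
Definition is_nc_laurent (A : pzRingType) (G : set A) (x : A) : Prop :=
  exists m : seq (int * seq A),
    (forall (k : int) (u : seq A) (y : A), (k, u) \in m -> y \in u ->
       G y \/ exists2 z, G z & y * z = 1 /\ z * y = 1) /\
    x = \sum_(ku <- m) (\prod_(y <- ku.2) y) *~ ku.1.

(* Main.v *)
Require Import Defs.
From HB Require Import structures.
From mathcomp Require Import all_boot all_order all_algebra.
From mathcomp Require Import all_classical all_reals all_analysis.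
From mathcomp Require Import zify ring lra.

Set Implicit Arguments.
Unset Strict Implicit.
Unset Printing Implicit Defensive.

Import Order.TTheory GRing.Theory Num.Theory.
Import numFieldNormedType.Exports.

Local Open Scope classical_set_scope.
Local Open Scope ring_scope.

(* The coefficients are integers, so the coordinates only matter up to sign. The
   disk being star-shaped, its bundle of directions is covered by the star-shaped
   space disk x R, over which the flat bundle has a global flat frame; a full turn
   changes the sign of this frame. Up to sign, the decoration therefore amounts to
   vectors V p and W p of A^2, and the coordinate from p to q is f_q (V p), where
   f_q is the linear form with kernel (V q) A and value 1 at W q. If {p, q} is an
   edge, expanding V r in the basis (V p, V q) gives
     f_i (V r) = f_i (V p) f_q (V p)^-1 f_q (V r)
               + f_i (V q) f_p (V q)^-1 f_p (V r).
   For a triangle {p, q, r} of the triangulation this expresses f_i (V r) by edge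
   coordinates, f_i (V p) and f_i (V q); the edge between i and its successor
   starts an induction that reaches all punctures, one triangle at a time. *)

(** * Right scalar multiplication, lines and free generators *)

Section RightScaling.
Context (A : pzRingType) (V : lmodType A^c).
Implicit Types (v w : V) (a c : A).

Lemma rscaleDl v w a : (v + w) *r a = v *r a + w *r a.
Proof. exact: scalerDr. Qed.

Lemma rscaleDr v a c : v *r (a + c) = v *r a + v *r c.
Proof. exact: scalerDl. Qed.

Lemma rscaleA v a c : v *r a *r c = v *r (a * c).
Proof. exact: scalerA. Qed.

Lemma rscaleNl v a : (- v) *r a = - (v *r a).
Proof. exact: scalerN. Qed.

Lemma rscaleNr v a : v *r (- a) = - (v *r a).
Proof. exact: scaleNr. Qed.

Lemma rscale0r v : v *r 0 = 0.
Proof. exact: scale0r. Qed.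

Lemma rscale1r v : v *r 1 = v.
Proof. exact: scale1r. Qed.

Lemma rlineD v x y : rline v x -> rline v y -> rline v (x + y).
Proof. by move=> [a ->] [c ->]; exists (a + c); rewrite rscaleDr. Qed.

Lemma rlineN v x : rline v x -> rline v (- x).
Proof. by move=> [a ->]; exists (- a); rewrite rscaleNr. Qed.

Lemma rlineZ v x a : rline v x -> rline v (x *r a).
Proof. by move=> [c ->]; exists (c * a); rewrite rscaleA. Qed.

Lemma rline_id v : rline v v.
Proof. by exists 1; rewrite rscale1r. Qed.

Lemma rline_opp v : rline (- v) = rline v.
Proof.
by apply/seteqP; split=> x [a ->]; exists (- a);
  rewrite rscaleNl rscaleNr ?opprK.
Qed.

Lemma basis2_freel (x y : V) a c : is_basis2 x y -> x *r a = x *r c -> a = c.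
Proof.
move=> B e; case: (B (x *r a)) => ac [_ U].
have E1 : ac = (a, 0) by apply: U; rewrite /= rscale0r addr0.
have E2 : ac = (c, 0) by apply: U; rewrite /= rscale0r addr0.
by move: E2; rewrite E1 => -[].
Qed.

End RightScaling.

(** * Linear forms with prescribed kernel *)

Section Covector.
Context (A : pzRingType) (V : lmodType A^c).

Definition is_covector (v w : V) (f : V -> A) : Prop :=
  [/\ {morph f : x y / x + y}, forall x a, f (x *r a) = f x * a, f w = 1
    & forall x, f x = 0 <-> rline v x].

(** Uniqueness of the coefficient of [z] modulo the line of [v] makes the chosen coefficients
    additive and right-linear in [z]. *)
Lemma covector_exists (v w : V) :
  (forall z, exists! a : A, rline v (z - w *r a)) ->
  exists f, is_covector v w f.
Proof.
move=> /choice [f fP]; exists f.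
have uf z a : rline v (z - w *r a) -> f z = a by case: (fP z) => _; apply.
have lf z : rline v (z - w *r f z) by case: (fP z).
split.
- move=> x y; apply: uf; rewrite rscaleDr opprD addrACA.
  exact: rlineD (lf x) (lf y).
- move=> x a; apply: uf; rewrite -rscaleA -rscaleNl -rscaleDl.
  exact: rlineZ (lf x).
- by apply: uf; rewrite rscale1r subrr; exists 0; rewrite rscale0r.
- move=> x; split=> [fx0|xl]; first by have := lf x; rewrite fx0 rscale0r subr0.
  by apply: uf; rewrite rscale0r subr0.
Qed.

Section Theory.
Context (v w : V) (f : V -> A) (fP : is_covector v w f).

Lemma covectorN x : f (- x) = - f x.
Proof.
case: fP => _ fZ _ _.
by rewrite -[x in LHS]rscale1r -rscaleNr fZ mulrN mulr1.
Qed.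

Lemma covector_coord x a : rline v (x - w *r a) -> f x = a.
Proof.
case: fP => fD fZ fw fK /fK; rewrite fD covectorN fZ fw mul1r.
by move=> /subr0_eq.
Qed.

Lemma covector_line : f v = 0.
Proof. by case: fP => _ _ _ fK; apply/fK; exact: rline_id. Qed.

(** Freeness of [u] and of the basis vector [x] makes them differ by a unit, which reduces the claim
    to [f x]. The component of [w] along [x] is a right inverse of [f x]; it is also a left inverse
    because the kernel of [f] is the line of [y], which meets that of [x] only in 0. *)
Lemma covector_unit u : is_regular u ->
  transverse_lines (rline u) (rline v) ->
  exists c : A, f u * c = 1 /\ c * f u = 1.
Proof.
case: fP => fD fZ fw fK [u' uB] [x [y [xu yv xyB]]].
have x_free := basis2_freel xyB; have u_free := basis2_freel uB.
have [s us] : rline x u by rewrite xu; exact: rline_id.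
have [t xt] : rline u x by rewrite -xu; exact: rline_id.
have st : s * t = 1.
  by apply: x_free; rewrite -rscaleA -us -xt rscale1r.
have ts : t * s = 1.
  by apply: u_free; rewrite -rscaleA -xt -us rscale1r.
have fy : f y = 0 by apply/fK; rewrite -yv; exact: rline_id.
case: (xyB w) => -[r r'] [/= wE _].
have fxr : f x * r = 1 by rewrite -fw wE fD !fZ fy mul0r addr0.
have rfx : r * f x = 1.
  have : rline y (x *r (r * f x - 1)).
    by rewrite yv; apply/fK; rewrite fZ mulrBr mulrA fxr mul1r mulr1 subrr.
  move=> [e ye]; apply/subr0_eq.
  case: (xyB (x *r (r * f x - 1))) => -[a0 c0] [_ U].
  have E1 : (a0, c0) = (r * f x - 1, 0) by apply: U; rewrite /= rscale0r addr0.
  have E2 : (a0, c0) = (0, e) by apply: U; rewrite /= rscale0r add0r.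
  by move: E2; rewrite E1 => -[].
exists (t * r); have fu : f u = f x * s by rewrite -fZ -us.
by rewrite fu; split; [rewrite mulrA -(mulrA (f x)) st mulr1|
  rewrite -mulrA (mulrA r) rfx mul1r].
Qed.

End Theory.

(* The exchange relation: expand u in the basis (x, y) and read off the
   coefficients with the covectors that kill y and x. *)
Lemma exchange (x y u w wx wy : V) (f fx fy : V -> A) (cx cy : A) v :
  is_covector v w f -> is_covector x wx fx -> is_covector y wy fy ->
  transverse_lines (rline x) (rline y) ->
  cy * fy x = 1 -> cx * fx y = 1 ->
  f u = f x * cy * fy u + f y * cx * fx u.
Proof.
move=> fP fxP fyP [x0 [y0 [xE yE B]]] cyE cxE.
case: (B u) => -[s t] [/= uE _].
have [s' s'E] : rline x (x0 *r s).
  by apply: rlineZ; rewrite -xE; exact: rline_id.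
have [t' t'E] : rline y (y0 *r t).
  by apply: rlineZ; rewrite -yE; exact: rline_id.
rewrite uE s'E t'E.
have fxx := covector_line fxP; have fyy := covector_line fyP.
case: fP fxP fyP => fD fZ _ _ [fxD fxZ _ _] [fyD fyZ _ _].
rewrite fD fxD fyD !fZ !fxZ !fyZ fxx fyy !mul0r addr0 add0r.
by rewrite !mulrA -(mulrA _ cy) cyE -(mulrA _ cx) cxE !mulr1.
Qed.

End Covector.

(** * Closure properties of non-commutative Laurent polynomials *)

Section Laurent.
Context (A : pzRingType) (G : set A).

Lemma nc_laurent_mono (y : A) :
  G y \/ (exists2 z, G z & y * z = 1 /\ z * y = 1) -> is_nc_laurent G y.
Proof.
move=> Gy; exists [:: (1, [:: y])]; split.
  by move=> k u x; rewrite inE => /eqP[_ ->]; rewrite inE => /eqP ->.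
by rewrite big_seq1 /= big_seq1.
Qed.

Lemma nc_laurent0 : is_nc_laurent G 0.
Proof. by exists [::]; split=> //; rewrite big_nil. Qed.

Lemma nc_laurentD x y : is_nc_laurent G x -> is_nc_laurent G y ->
  is_nc_laurent G (x + y).
Proof.
move=> [m [mG ->]] [m' [mG' ->]]; exists (m ++ m'); split; last first.
  by rewrite big_cat.
by move=> k u z; rewrite mem_cat => /orP[/mG|/mG']; apply.
Qed.

Lemma nc_laurentM x y : is_nc_laurent G x -> is_nc_laurent G y ->
  is_nc_laurent G (x * y).
Proof.
move=> [m [mG ->]] [m' [mG' ->]].
exists [seq (s.1 * t.1, s.2 ++ t.2) | s <- m, t <- m']; split.
  move=> k u z /allpairsP[[[k1 u1] [k2 u2]] /= [/mG h1 /mG' h2 [_ ->]]].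
  by rewrite mem_cat => /orP[/h1|/h2].
rewrite big_allpairs_dep /= mulr_suml; apply: eq_bigr => s _.
rewrite mulr_sumr; apply: eq_bigr => t _.
by rewrite big_cat /= mulrzAl mulrzAr -mulrzA mulrC.
Qed.

Lemma nc_laurentN x : is_nc_laurent G x -> is_nc_laurent G (- x).
Proof.
move=> xG; rewrite -mulN1r; apply: nc_laurentM => //.
exists [:: (-1, [::])]; split; first by move=> k u y; rewrite inE => /eqP[_ ->].
by rewrite big_seq1 /= big_nil.
Qed.

Lemma nc_laurent_sign x y : x = y \/ x = - y ->
  is_nc_laurent G y -> is_nc_laurent G x.
Proof. by move=> [->|->] //; exact: nc_laurentN. Qed.

(** Coordinates are known only up to sign; the inverse of [- y] is minus the inverse of [y], so
    inversion respects this ambiguity. *)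
Lemma nc_laurent_inv_sign x y c : x = y \/ x = - y -> G y ->
  x * c = 1 -> c * x = 1 -> is_nc_laurent G c.
Proof.
move=> [->|->] Gy yc cy; first by apply: nc_laurent_mono; right; exists y.
rewrite -[c]opprK; apply: nc_laurentN; apply: nc_laurent_mono; right.
by exists y => //; split; [rewrite mulNr -mulrN|rewrite mulrN -mulNr].
Qed.

End Laurent.

(** * Exhausting the punctures by triangles *)

Section Sweep.
Context (n : nat) (T : ideal_triangulation n) (good : 'I_n -> Prop).
Context (good_step : forall p q r : 'I_n,
  T p q -> T p r -> T q r -> good p -> good q -> good r).

Lemma ordS_val (i : 'I_n) : (ordS i : nat) = if i.+1 == n then 0%N else i.+1.
Proof.
have := ltn_ord i; rewrite /=; case: eqP => [->|ne] lt; first by rewrite modnn.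
by rewrite modn_small //; lia.
Qed.

(** Induction on a bound [d] for the counterclockwise distance from [a] to [c]: the apex [l] of the
    triangle on that side is good by [good_step], and the edges from [a] to [l] and from [l] to [c]
    span strictly smaller distances. *)
Lemma sweep_edge (d : nat) (a c : 'I_n) :
  ((if a <= c then c - a else c + n - a) <= d)%N ->
  T a c -> good a -> good c -> forall k, ccw a k c -> good k.
Proof.
elim: d a c => [|d IH] a c dle Tac ga gc k akc.
  have ne : a <> c by move=> e; move: Tac; rewrite e edge_irr.
  have : nat_of_ord a != c by apply/eqP => /val_inj.
  by have := ltn_ord a; have := ltn_ord c; move: dle; case: (leqP a c); lia.
(* No vertex lies strictly between [a] and its successor, so the existence of [k] ensures that there
   is a triangle on this side. *)
have aS : c != ordS a.
  apply/eqP => e; move: akc; rewrite e /ccw ordS_val.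
  by have := ltn_ord a; have := ltn_ord k; case: eqP; lia.
have [l [alc Tal Tlc]] := edge_triangle Tac aS.
have gl : good l by apply: (@good_step a c); rewrite // edge_sym.
have [->//|kl] := eqVneq k l.
have {}kl : nat_of_ord k != l by apply: contra_neq kl => /val_inj.
have la := ltn_ord a; have lc := ltn_ord c; have lk := ltn_ord k.
have ll := ltn_ord l.
have [akl|lkc] : ccw a k l \/ ccw l k c.
  by move: akc alc; rewrite /ccw; lia.
- apply: (IH a l) => //.
  by move: dle alc; rewrite /ccw; case: (leqP a c); case: (leqP a l); lia.
- apply: (IH l c) => //.
  by move: dle alc; rewrite /ccw; case: (leqP a c); case: (leqP l c); lia.
Qed.

Lemma sweep (i : 'I_n) : good i -> good (ordS i) -> forall r, good r.
Proof.
move=> gi gS r.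
have [->//|ri] := eqVneq r i; have [->//|rS] := eqVneq r (ordS i).
(* Taken from [ordS i] to [i], the boundary edge has all the other punctures strictly between its
   ends. *)
apply: (@sweep_edge _ (ordS i) i (leqnn _)) => //.
  by rewrite edge_sym edge_boundary.
have {}ri : nat_of_ord r != i by apply: contra_neq ri => /val_inj.
have {}rS : nat_of_ord r != ordS i by apply: contra_neq rS => /val_inj.
move: rS; rewrite /ccw ordS_val.
by have := ltn_ord i; have := ltn_ord r; case: (eqVneq i.+1 n); lia.
Qed.

End Sweep.

(** * The Laurent property for vectors and forms in a fixed module *)

Section LaurentCoordinates.
Context (A : pzRingType) (M : lmodType A^c) (n : nat).
Context (T : ideal_triangulation n) (V W : 'I_n -> M) (G : set A).
Context (V_regular : forall p, is_regular (V p)).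
Context (W_basis : forall p z, exists! a : A, rline (V p) (z - W p *r a)).
Context (T_transverse : forall p q,
  T p q -> transverse_lines (rline (V p)) (rline (V q))).
Context (T_coord : forall p q, T p q -> exists2 a, G a &
  rline (V q) (V p - W q *r a) \/ rline (V q) (V p + W q *r a)).

Lemma laurent_coordinates (i j : 'I_n) a :
  rline (V i) (V j - W i *r a) \/ rline (V i) (V j + W i *r a) ->
  is_nc_laurent G a.
Proof.
have /choice [f fP] p : exists fp, is_covector (V p) (W p) fp.
  exact/covector_exists/W_basis.
have fE p q c : rline (V q) (V p - W q *r c) \/ rline (V q) (V p + W q *r c) ->
    f q (V p) = c \/ f q (V p) = - c.
  move=> [l|l]; [left|right]; apply: (covector_coord (fP q)) => //.
  by rewrite rscaleNr opprK.
have TG p q : T p q -> is_nc_laurent G (f q (V p)).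
  move=> /T_coord[c Gc /fE h]; apply: nc_laurent_sign h _.
  by apply: nc_laurent_mono; left.
(* Transversality makes the value of the form a unit; its inverse is, up to sign, the inverse of an
   edge coordinate. *)
have Tinv p q : T p q -> exists2 c, is_nc_laurent G c & c * f q (V p) = 1.
  move=> Tpq; have [c Gc /fE h] := T_coord Tpq.
  have [e [e1 e2]] := covector_unit (fP q) (V_regular p) (T_transverse Tpq).
  by exists e => //; apply: nc_laurent_inv_sign h Gc e1 e2.
move=> ja; suff : is_nc_laurent G (f i (V j)).
  apply: nc_laurent_sign; case: (fE j i a ja) => ->; first by left.
  by right; rewrite opprK.
pose good r := is_nc_laurent G (f i (V r)).
apply: (@sweep n T good _ i).
- move=> p q r Tpq Tpr Tqr gp gq.
  have Tqp : T q p by rewrite edge_sym.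
  have [cy cyG cyE] := Tinv _ _ Tpq; have [cx cxG cxE] := Tinv _ _ Tqp.
  rewrite /good
    (exchange (V r) (fP i) (fP p) (fP q) (T_transverse Tpq) cyE cxE).
  by apply: nc_laurentD; apply: nc_laurentM;
    [apply: nc_laurentM| |apply: nc_laurentM|] => //; apply: TG;
    rewrite edge_sym.
(* Starting values of the sweep: [f i] kills [V i], and its value at [V (ordS i)] is, up to sign,
   the coordinate of a boundary edge. *)
- by rewrite /good (covector_line (fP i)); exact: nc_laurent0.
- by apply: TG; rewrite edge_sym edge_boundary.
Qed.

End LaurentCoordinates.

(** * Isomorphisms of right modules *)

Section RightIsomorphisms.
Context (A : pzRingType).

Definition risom (V W : lmodType A^c) (h : V -> W) : Prop :=
  [/\ {morph h : x y / x + y}, forall x a, h (x *r a) = h x *r a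
    & bijective h].

Lemma risom_id (V : lmodType A^c) : risom (@id V).
Proof. by split=> //; exists id. Qed.

Lemma risom_comp (U V W : lmodType A^c) (g : V -> W) (h : U -> V) :
  risom g -> risom h -> risom (g \o h).
Proof.
move=> [gD gZ gB] [hD hZ hB]; split; last exact: bij_comp.
- by move=> x y /=; rewrite hD gD.
- by move=> x a /=; rewrite hZ gZ.
Qed.

Context (V W : lmodType A^c) (h : V -> W) (hP : risom h).

Lemma risomN x : h (- x) = - h x.
Proof.
case: hP => _ hZ _.
by rewrite -[x in LHS]rscale1r -rscaleNr hZ rscaleNr rscale1r.
Qed.

Lemma risomB x y : h (x - y) = h x - h y.
Proof. by rewrite -risomN; case: hP => ->. Qed.

Lemma risom_inj : injective h.
Proof. by case: hP => _ _ /bij_inj. Qed.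

Lemma risom_surj y : exists x, h x = y.
Proof. by case: hP => _ _ [k _ kh]; exists (k y). Qed.

Lemma risom_rline x y : rline (h x) (h y) <-> rline x y.
Proof.
case: hP => _ hZ _; split=> -[a e]; exists a; last by rewrite e hZ.
by apply: risom_inj; rewrite e hZ.
Qed.

Lemma risom_basis2 x y : is_basis2 (h x) (h y) -> is_basis2 x y.
Proof.
case: (hP) => hD hZ _ B z; case: (B (h z)) => ac [acE U]; exists ac; split.
  by apply: risom_inj; rewrite hD !hZ.
by move=> ac' e; apply: U; rewrite e hD !hZ.
Qed.

Lemma risom_regular x : is_regular (h x) -> is_regular x.
Proof.
by move=> [y B]; have [z zy] := risom_surj y; exists z;
  apply: risom_basis2; rewrite zy.
Qed.

Lemma risom_transverse x y :
  transverse_lines (rline (h x)) (rline (h y)) ->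
  transverse_lines (rline x) (rline y).
Proof.
move=> [x1 [y1 [xE yE B]]].
have [x2 x2E] := risom_surj x1; have [y2 y2E] := risom_surj y1.
have lineE u u1 u2 : rline u1 = rline (h u) -> h u2 = u1 -> rline u2 = rline u.
  move=> uE u2E; apply/seteqP.
  by split=> z zu; apply: (risom_rline _ _).1;
    [rewrite -uE -u2E|rewrite u2E uE]; apply: (risom_rline _ _).2.
exists x2, y2; split; [exact: lineE xE x2E|exact: lineE yE y2E|].
by apply: risom_basis2; rewrite x2E y2E.
Qed.

End RightIsomorphisms.

(** * Continuous induction on a segment *)

Section RealSegments.
Context (R : realType).

Lemma near_segment (a b t0 : R) (Q : R -> Prop) :
  (\forall t \near within `[a, b] (nbhs t0), Q t) ->
  exists2 e, 0 < e & forall t, a <= t <= b -> `|t - t0| < e -> Q t.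
Proof.
move=> /nbhs_ballP[e /= e0 h]; exists e => // t tab te.
apply: h; last by rewrite /= in_itv.
by rewrite /ball /= distrC.
Qed.

(** Connectedness of the segment, in the form that glues local statements made in charts. A supremum
    argument moves to the right; as the local hypothesis is symmetric in [t1] and [t2], the move to
    the left follows. *)
Lemma segment_ind (P : R -> Prop) (a b : R) :
  (forall t, a <= t <= b -> exists2 e, 0 < e &
     forall t1 t2, a <= t1 <= b -> a <= t2 <= b ->
       `|t1 - t| < e -> `|t2 - t| < e -> P t1 -> P t2) ->
  forall t1 t2, a <= t1 <= b -> a <= t2 <= b -> P t1 -> P t2.
Proof.
have forward (Q : R -> Prop) (x y : R) :
    (forall t, x <= t <= y -> exists2 e, 0 < e &
     forall t1 t2, x <= t1 <= y -> x <= t2 <= y ->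
       `|t1 - t| < e -> `|t2 - t| < e -> Q t1 -> Q t2) ->
    x <= y -> Q x -> Q y.
  move=> loc xy Qx.
  pose S := [set t | x <= t <= y /\ Q t].
  have Sx : S x by rewrite /S /= lexx xy.
  have hS : has_sup S by split; [exists x|exists y => t [/andP[]]].
  have supS : x <= sup S <= y.
    apply/andP; split; first exact: ub_le_sup hS.2 _ Sx.
    by apply: ge_sup; [exists x|move=> t [/andP[]]].
  have [e e0 he] := loc _ supS.
  have [t1 [t1xy Qt1] t1s] := sup_adherent e0 hS.
  have t1le : t1 <= sup S by apply: ub_le_sup; [exact: hS.2|].
  have near1 : `|t1 - sup S| < e by rewrite ler0_norm; lra.
  have [//|lt] : sup S = y \/ sup S < y.
    by case/andP: supS => _; rewrite le_eqVlt => /orP[/eqP|]; [left|right].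
    move=> e1; rewrite -e1; apply: he Qt1 => //.
    by rewrite subrr normr0.
  (* If the supremum were smaller than [y], [t2] would be a point of [S] beyond it. *)
  pose t2 := Num.min y (sup S + e / 2).
  have [t2y t2s t2S] : [/\ t2 <= y, t2 <= sup S + e / 2 & sup S < t2].
    split; rewrite ?ge_min ?lexx ?orbT // lt_min lt /=; lra.
  have : S t2.
    split; first by lra.
    apply: he Qt1 => //; first by lra.
    by rewrite ger0_norm; lra.
  by move=> /(ub_le_sup hS.2); lra.
move=> loc t1 t2 t1ab t2ab.
have [le|le] := leP t1 t2.
  apply: forward le => t tt; have [|e e0 he] := loc t; first lra.
  by exists e => // s1 s2 ? ?; apply: he; lra.
(* To move left, the argument runs for the negation of [P], from [t2] up to [t1]. *)
move=> Pt1; apply: contrapT => nPt2; move: Pt1.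
apply: (forward (fun t => ~ P t) t2 t1) (ltW le) nPt2 => t tt.
have [|e e0 he] := loc t; first lra.
exists e => // s1 s2 h1 h2 d1 d2 nP /he; apply: contra_not nP => h.
by apply: h; lra.
Qed.

End RealSegments.

(** [(A^c)^o] is the regular left module of the converse ring, that is, [A] as a right module over
    itself. *)
Definition rank2 (A : pzRingType) : lmodType A^c := ((A^c)^o * (A^c)^o)%type.

(** * Parallel transport in a flat bundle *)

Section FlatBundle.
Context (A : pzRingType) (X : topologicalType) (D : set X).
Context (B : flat_bundle2 A D).

Lemma in_fib_inj x (z z' : B x) : in_fib x z = in_fib x z' -> z = z'.
Proof.
move=> e; apply: (Eqdep_dec.inj_pair2_eq_dec X _ (fun y => B y : Type)) e.
exact: eq_comparable.
Qed.

Definition comb (i : chart B) (x : X) (u : rank2 A) : B x :=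
  frame1 i x *r (u.1 : A) + frame2 i x *r (u.2 : A).

Definition tot (i : chart B) (x : X) (u : rank2 A) : total_space B :=
  in_fib x (comb i x u).

Lemma risom_comb i x : D x -> chart_dom i x -> risom (comb i x).
Proof.
move=> Dx ix; have fB := frame_basis Dx ix.
split.
- by move=> u v; rewrite /comb /= !rscaleDr addrACA.
- by move=> u a; rewrite /comb rscaleDl !rscaleA.
have /choice [k kP] z : exists u, comb i x u = z.
  by case: (fB z) => u [-> _]; exists u.
exists k => [u|z]; last exact: kP.
case: (fB (comb i x u)) => u0 [_ U].
by rewrite -[RHS](U u) // -(U (k (comb i x u))) // -[LHS]kP.
Qed.

Lemma tot_inj i x : D x -> chart_dom i x -> injective (tot i x).
Proof.
by move=> Dx ix u v /in_fib_inj; exact: risom_inj (risom_comb Dx ix) _ _.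
Qed.

Lemma tot_surj i x q : D x -> chart_dom i x -> projT1 q = x ->
  exists u, q = tot i x u.
Proof.
move=> Dx ix; case: q => y z /= e; subst y.
have [u <-] := risom_surj (risom_comb Dx ix) z; by exists u.
Qed.

(** [k] is the action of the matrix from [frame_flat] on coordinate vectors. It is bijective since
    at [x] it equals the inverse of [comb i x] after [comb j x]. *)
Lemma transition i j x : D x -> chart_dom i x -> chart_dom j x ->
  exists2 k : rank2 A -> rank2 A, risom k &
    \forall y \near within D (nbhs x), forall u, comb j y u = comb i y (k u).
Proof.
move=> Dx ix jx; have [g11 [g21 [g12 [g22 g]]]] := frame_flat Dx ix jx.
pose k (u : rank2 A) : rank2 A :=
  ((g11 * (u.1 : A) + g12 * (u.2 : A) : A),
   (g21 * (u.1 : A) + g22 * (u.2 : A) : A)).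
have kP : \forall y \near within D (nbhs x),
    forall u, comb j y u = comb i y (k u).
  apply: filterS g => y [e1 e2] u.
  by rewrite /comb e1 e2 /= !rscaleDl !rscaleDr !rscaleA addrACA.
exists k => //.
have [iD iZ iB] := risom_comb Dx ix; have [jD jZ jB] := risom_comb Dx jx.
have kx u : comb j x u = comb i x (k u) by exact: (nbhs_singleton kP).
split.
- move=> u v; apply/(bij_inj iB); by rewrite -kx jD iD !kx.
- move=> u a; apply/(bij_inj iB); by rewrite -kx jZ iZ !kx.
- case: (iB) => f fi if_; apply: (@eq_bij _ _ (f \o comb j x)).
    by apply: bij_comp => //; exists (comb i x).
  by move=> u /=; rewrite kx fi.
Qed.

Lemma transition_tot i j x : D x -> chart_dom i x -> chart_dom j x ->
  exists2 k : rank2 A -> rank2 A, risom k &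
    \forall y \near within D (nbhs x), forall u, tot j y u = tot i y (k u).
Proof.
move=> Dx ix jx; have [k kP h] := transition Dx ix jx; exists k => //.
by apply: filterS h => y e u; rewrite /tot e.
Qed.

Section Paths.
Context (R : realType).

Definition cpath (c : R -> X) (a b : R) : Prop :=
  forall t, a <= t <= b -> D (c t) /\ {for t, continuous c}.

Lemma cpath_near c a b t (Q : X -> Prop) : cpath c a b -> a <= t <= b ->
  (\forall x \near within D (nbhs (c t)), Q x) ->
  exists2 e, 0 < e &
    forall t', a <= t' <= b -> `|t' - t| < e -> Q (c t').
Proof.
move=> cP tab; have [Dt /(_ _) ct] := cP t tab.
rewrite near_withinE => /ct /nbhs_ballP[e /= e0 h]; exists e => // t' t'ab te.
by apply: h; [rewrite /ball /= distrC|case: (cP t' t'ab)].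
Qed.

(** A parallel frame along [c], which transports all vectors of A^2 at once: locally its coordinates
    [h] in some chart are constant. *)
Definition framed (c : R -> X) (a b : R) (S : R -> rank2 A -> total_space B) :=
  forall t0, a <= t0 <= b ->
  exists i h, [/\ chart_dom i (c t0), risom h &
    exists2 e, 0 < e & forall t, a <= t <= b -> `|t - t0| < e ->
      forall m, S t m = tot i (c t) (h m)].

(** Since transition maps are locally constant, so are the coordinates of a parallel frame in the
    chart [i]; [segment_ind] makes them constant on the part of the path inside this chart. *)
Lemma framed_extend c a b S i g t1 t2 : cpath c a b -> framed c a b S ->
  a <= t1 <= b -> a <= t2 <= b ->
  (forall t, a <= t <= b -> Num.min t1 t2 <= t <= Num.max t1 t2 ->
     chart_dom i (c t)) ->
  (forall m, S t1 m = tot i (c t1) (g m)) ->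
  forall m, S t2 m = tot i (c t2) (g m).
Proof.
move=> cP SP t1ab t2ab idom.
pose x := Num.min t1 t2; pose y := Num.max t1 t2.
have [xt1 xt2 t1y t2y] : [/\ x <= t1, x <= t2, t1 <= y & t2 <= y].
  by rewrite /x /y !ge_min !le_max !lexx !orbT.
have [ax yb] : a <= x /\ y <= b.
  by rewrite /x /y ge_max le_min; split; apply/andP; split; lra.
apply: (@segment_ind R (fun t => forall m, S t m = tot i (c t) (g m)) x y);
  [|lra|lra].
move=> t txy; have tab : a <= t <= b by lra.
have Dct := (cP t tab).1; have ict := idom t tab txy.
have [j [h [jt hP [e e0 he]]]] := SP t tab.
have [k kP near_k] := transition_tot Dct ict jt.
have [e' e'0 he'] := cpath_near cP tab near_k.
exists (Num.min e e'); first by rewrite lt_min e0.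
move=> s1 s2 s1xy s2xy; rewrite !lt_min => /andP[d1 d1'] /andP[d2 d2'] E m.
have s1ab : a <= s1 <= b by lra.
have s2ab : a <= s2 <= b by lra.
rewrite he // he' //; congr (tot _ _ _).
apply: (tot_inj (cP s1 s1ab).1 (idom s1 s1ab s1xy)).
by rewrite -E he // he'.
Qed.

(** Near any parameter one chart contains the path, and there [framed_extend] determines both frames
    from the same coordinates [g]. *)
Lemma framed_unique c a b S S' t1 t2 : cpath c a b ->
  framed c a b S -> framed c a b S' -> a <= t1 <= b -> a <= t2 <= b ->
  (forall m, S t1 m = S' t1 m) -> forall m, S t2 m = S' t2 m.
Proof.
move=> cP SP SP'.
apply: (segment_ind (P := fun t => forall m, S t m = S' t m)) => t tab.
have [i it] := chart_cover B (cP t tab).1.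
have [e e0 he] := cpath_near cP tab (chart_open (cP t tab).1 it).
exists e => // s1 s2 s1ab s2ab d1 d2 E m.
have idom u : a <= u <= b -> Num.min s1 s2 <= u <= Num.max s1 s2 ->
    chart_dom i (c u).
  move=> uab; rewrite ge_min le_max => us; apply: he => //.
  move: d1 d2; rewrite !ltr_norml => ? ?.
  by case/andP: us => /orP[?|?] /orP[?|?]; lra.
have [i1 [h1 [i1d _ [e1 e10 he1]]]] := SP s1 s1ab.
have s1d : chart_dom i (c s1) by apply: he.
have /choice [g gE] m0 : exists u, S s1 m0 = tot i (c s1) u.
  apply: tot_surj => //; first exact: (cP s1 s1ab).1.
  by rewrite he1 // subrr normr0.
rewrite (framed_extend cP SP s1ab s2ab idom gE).
by rewrite (framed_extend (g := g) cP SP' s1ab s2ab idom) // => m0; rewrite -E.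
Qed.

Lemma framed_sub c a b a' b' S : a <= a' -> b' <= b ->
  framed c a b S -> framed c a' b' S.
Proof.
move=> aa bb SP t tab; have [|i [h [it hP [e e0 he]]]] := SP t; first lra.
by exists i, h; split=> //; exists e => // s sab; apply: he; lra.
Qed.

(** [segment_ind] applies to the right end [b'] of the interval on which a frame exists: moving it
    left is restriction, moving it right is continuation inside one chart. *)
Lemma framed_exists c a b i : a <= b -> cpath c a b -> chart_dom i (c a) ->
  exists2 S, framed c a b S & forall m, S a m = tot i (c a) m.
Proof.
move=> ab cP ia.
pose P b' := exists2 S, framed c a b' S & forall m, S a m = tot i (c a) m.
apply: (@segment_ind R P a b _ a b); [|lra|lra|]; last first.
  exists (fun t m => tot i (c t) m) => // t ta.
  have {ta}-> : t = a by lra.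
  exists i, id; split=> //; first exact: risom_id.
  by exists 1.
move=> t tab; have [j jt] := chart_cover B (cP t tab).1.
have [e e0 he] := cpath_near cP tab (chart_open (cP t tab).1 jt).
exists e => // t1 t2 t1ab t2ab d1 d2 [S SP Sa].
have [le|lt] := leP t2 t1; first by exists S => //; apply: framed_sub SP.
have jd s : t1 <= s <= t2 -> chart_dom j (c s).
  by move=> sP; apply: he; move: d1 d2; rewrite ?ltr_norml; lra.
have Dt s : t1 <= s <= t2 -> D (c s) by move=> sP; have [|//] := cP s; lra.
have [|i1 [h1 [i1d h1P [e1 e10 he1]]]] := SP t1; first lra.
have t1P : t1 <= t1 <= t2 by lra.
have [k kP near_k] := transition_tot (Dt _ t1P) (jd _ t1P) i1d.
have [e2 e20 he2] := cpath_near cP t1ab near_k.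
(* Beyond [t1] the frame continues with constant coordinates in the chart [j], equal to those it has
   there at [t1]. *)
pose S' s := if s <= t1 then S s else fun m => tot j (c s) (k (h1 m)).
exists S'; last by rewrite /S'; case: leP => //; lra.
move=> s sP; have [lts|lts|es] := ltgtP s t1.
- have [|i2 [h2 [i2d h2P [e3 e30 he3]]]] := SP s; first lra.
  exists i2, h2; split=> //; exists (Num.min e3 (t1 - s)).
    by rewrite lt_min e30; lra.
  move=> u uP; rewrite lt_min => /andP[u3 u1] m.
  have ut : u <= t1 by move: u1; rewrite ltr_norml; lra.
  by rewrite /S' ut he3 //; lra.
- exists j, (k \o h1); split; [apply: jd; lra|exact: risom_comp|].
  exists (s - t1); first lra.
  move=> u uP u1 m; have ut : t1 < u by move: u1; rewrite ltr_norml; lra.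
  by rewrite /S' leNgt ut.
(* At the junction [t1] both halves are written in the chart [j], the left one through the
   transition [k]. *)
- exists j, (k \o h1); split; [apply: jd; lra|exact: risom_comp|].
  exists (Num.min e1 e2); first by rewrite lt_min e10.
  move=> u uP; rewrite es lt_min => /andP[u1 u2] m.
  rewrite /S'; case: leP => // ut.
  by rewrite he1 //; [apply: he2 => //; lra|lra].
Qed.

End Paths.
End FlatBundle.

(** * Continuity of pairs, angles and unit vectors *)

Lemma continuous_pair (T U V : topologicalType) (f : T -> U) (g : T -> V) x :
  {for x, continuous f} -> {for x, continuous g} ->
  {for x, continuous (fun y => (f y, g y))}.
Proof. by move=> cf cg; exact: (cvg_pair cf cg). Qed.

Lemma continuous_fst (U V : topologicalType) : continuous (@fst U V).
Proof. by move=> x; exact: cvg_fst. Qed.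

Lemma continuous_snd (U V : topologicalType) : continuous (@snd U V).
Proof. by move=> x; exact: cvg_snd. Qed.

Section UnitVectors.
Context (R : realType).
Implicit Types (a b t : R) (u : plane R).

Lemma sqnorm_unit_vec a : sqnorm (unit_vec a) = 1.
Proof. exact: cos2Dsin2. Qed.

Lemma unit_vecD2pi a : unit_vec (a + 2 * pi) = unit_vec a.
Proof.
have -> : 2 * pi = pi *+ 2 :> R by rewrite mulr_natl.
by rewrite /unit_vec cosD2pi sinD2pi.
Qed.

(** The cosine of [b - a] is 1, so the sine of half of it vanishes; this half lies in [0, pi), where
    only 0 has sine 0. *)
Lemma unit_vec_inj_turn a b : unit_vec a = unit_vec b -> a <= b < a + 2 * pi ->
  a = b.
Proof.
move=> [ec es] ab; apply/eqP; rewrite eq_sym -subr_eq0; apply/eqP.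
pose r := (b - a) / 2; have rE : b - a = r *+ 2 by rewrite /r mulr2n; lra.
have c1 : cos (b - a) = 1.
  rewrite cosD cosN sinN ec es mulrN opprK -!expr2; exact: cos2Dsin2.
have s0 : sin r ^+ 2 = 0.
  by move: c1; rewrite rE cos_mulr2n cos2sin2 mulr2n; lra.
have {s0} : sin r == 0 by rewrite -sqrf_eq0 s0.
have [r0|r0] := eqVneq r 0; first by rewrite rE r0 mul0rn.
have : 0 < r < pi by move/eqP : r0; rewrite /r; lra.
by move=> /sin_gt0_pi; rewrite lt0r => /andP[/negbTE ->].
Qed.

Lemma unit_vec_inj a b : unit_vec a = unit_vec b ->
  exists n : nat, b = a + (2 * pi) *+ n \/ a = b + (2 * pi) *+ n.
Proof.
wlog ab : a b / a <= b => [hw|] e.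
  have [/hw|/ltW/hw] := leP a b; first exact.
  by move=> /(_ (esym e)) [n [h|h]]; exists n; [right|left].
have p0 : 0 < 2 * pi :> R by have := pi_gt0 R; lra.
(* The integer part is the number of full turns in [b - a]; removing them leaves less than one
   turn. *)
have /truncn_itv : 0 <= (b - a) / (2 * pi) by rewrite divr_ge0 ?subr_ge0 // ltW.
set n := Num.truncn _; rewrite ler_pdivlMr // ltr_pdivrMr // => nP.
exists n; left.
have -> : b = (b - (2 * pi) *+ n) + (2 * pi) *+ n by rewrite subrK.
congr (_ + _); apply/esym/unit_vec_inj_turn.
  rewrite e -{1}[b](subrK ((2 * pi) *+ n)).
  elim: n {nP} => [|n IH]; first by rewrite !mulr0n subr0 addr0.
  have -> : b - (2 * pi) *+ n.+1 + (2 * pi) *+ n.+1 =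
    b - (2 * pi) *+ n + (2 * pi) *+ n by rewrite !subrK.
  rewrite IH -[RHS]unit_vecD2pi; congr unit_vec.
  by rewrite mulrSr; lra.
move: nP; rewrite -[_ *+ n]mulr_natl -natr1; lra.
Qed.

Lemma unit_vec_surj u : sqnorm u = 1 -> exists a, u = unit_vec a.
Proof.
case: u => x y; rewrite /sqnorm /unit_vec /= => e.
have x1 : -1 <= x <= 1.
  by rewrite -ler_norml -(ler_pXn2r (n := 2)) ?nnegrE // expr1n
    real_normK ?num_real //; nra.
have yE : Num.sqrt (1 - x ^+ 2) = `|y|.
  by rewrite -e [_ + y ^+ 2]addrC addrK sqrtr_sqr.
have [y0|y0] := leP 0 y.
  exists (acos x); rewrite acosK ?in_itv //= sin_acos // yE.
  by rewrite ger0_norm.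
exists (- acos x); rewrite cosN sinN acosK ?in_itv //= sin_acos // yE.
by rewrite ltr0_norm // opprK.
Qed.

Lemma continuous_unit_vec : continuous (@unit_vec R).
Proof.
move=> a.
by apply: continuous_pair; [exact: continuous_cos|exact: continuous_sin].
Qed.

(* The angle of u near the direction of angle a, obtained from the sine of the
   angle between them. *)
Definition local_angle (a : R) (u : plane R) : R :=
  a + asin (cos a * u.2 - sin a * u.1).

Lemma local_angle_id a : local_angle a (unit_vec a) = a.
Proof.
rewrite /local_angle /= mulrC subrr.
have := @sinK R 0; rewrite sin0 => -> ; first by rewrite addr0.
by rewrite in_itv /=; have := pi_gt0 R; lra.
Qed.

Lemma continuous_local_angle a :
  {for unit_vec a, continuous (local_angle a)}.
Proof.
apply: cvgD; first exact: cvg_cst.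
apply: (@continuous_comp _ _ _ (fun u : plane R => cos a * u.2 - sin a * u.1)
  (@asin R)).
  apply: cvgB; (apply: cvgM; first exact: cvg_cst).
    exact: continuous_snd.
  exact: continuous_fst.
by apply: continuous_asin; rewrite /= mulrC subrr; lra.
Qed.

(** With a positive inner product, [u] is within a quarter turn of the angle [a]. There the arcsine
    recovers the angle, whose cosine is the positive root, namely the inner product. *)
Lemma unit_vec_local_angle a u : sqnorm u = 1 ->
  0 < cos a * u.1 + sin a * u.2 -> unit_vec (local_angle a u) = u.
Proof.
case: u => x y; rewrite /sqnorm /local_angle /unit_vec /= => e d0.
have ca := cos2Dsin2 a; rewrite cosD sinD.
set c := cos a in d0 ca *; set s := sin a in d0 ca *.
have E : (c * x + s * y) ^+ 2 + (c * y - s * x) ^+ 2 = 1.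
  have -> : (c * x + s * y) ^+ 2 + (c * y - s * x) ^+ 2 =
    (c ^+ 2 + s ^+ 2) * (x ^+ 2 + y ^+ 2) by ring.
  by rewrite ca e mulr1.
have r1 : -1 <= c * y - s * x <= 1.
  by rewrite -ler_norml -(ler_pXn2r (n := 2)) ?nnegrE // expr1n
    real_normK ?num_real //; nra.
rewrite asinK ?in_itv //= cos_asin // -E addrK sqrtr_sqr gtr0_norm //.
by congr pair; [rewrite -[RHS]mul1r -ca|rewrite -[RHS]mul1r -ca]; ring.
Qed.

Lemma near_unit_vec_local_angle a :
  \forall u \near unit_vec a, sqnorm u = 1 -> unit_vec (local_angle a u) = u.
Proof.
have : (fun u : plane R => cos a * u.1 + sin a * u.2) @ unit_vec a --> (1 : R).
  rewrite -(cos2Dsin2 a) !expr2.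
  apply: cvgD; (apply: cvgM; first exact: cvg_cst).
    exact: (@continuous_fst _ _ (unit_vec a)).
  exact: (@continuous_snd _ _ (unit_vec a)).
move=> /(@cvgr_gt R _ _ _ _ 1) /(_ 0 ltr01).
by apply: filterS => u /= u0 u1; apply: unit_vec_local_angle.
Qed.

End UnitVectors.

(** * Parallel transport in families of paths, and frames up to sign *)

(** Joint continuity lets one chart contain all paths with [y] near [y0] during a short time, so
    coordinates of parallel frames stay constant there; [segment_ind] in time chains these
    intervals. Transport from the common starting point is thus flat in [y]. *)
Lemma framed_family (R : realType) (A : pzRingType) (X Y : topologicalType)
    (D : set X) (B : flat_bundle2 A D) (E : set Y) (K : R -> Y -> X)
    (i0 : chart B) (x0 : X) (y0 : Y) :
  (forall y, E y -> cpath D (K^~ y) 0 1) ->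
  (forall t, 0 <= t <= 1 ->
    {for (t, y0), continuous (fun ty : R * Y => K ty.1 ty.2)}) ->
  (forall y, E y -> K 0 y = x0) -> chart_dom i0 x0 -> E y0 ->
  exists i h, [/\ chart_dom i (K 1 y0), risom h &
    \forall y \near y0, E y -> forall S, framed (K^~ y) 0 1 S ->
      (forall m, S 0 m = tot i0 x0 m) -> forall m, S 1 m = tot i (K 1 y) (h m)].
Proof.
move=> KP Kc K0 i0x0 Ey0.
have near_K t (Q : X -> Prop) : 0 <= t <= 1 ->
    (\forall x \near within D (nbhs (K t y0)), Q x) ->
    exists2 e, 0 < e & \forall y \near y0, E y -> forall t',
      0 <= t' <= 1 -> `|t' - t| < e -> Q (K t' y).
  move=> t01; rewrite near_withinE => /(Kc t t01) [[U N] /= [Ut Ny] UN].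
  move/nbhs_ballP : Ut => [e /= e0 he]; exists e => //.
  apply: filterS Ny => y Ny Ey t' t'01 te.
  apply: (UN (t', y)); last by have [] := KP y Ey t' t'01.
  by split=> //=; apply: he; rewrite /ball /= distrC.
pose P t := exists i h, [/\ chart_dom i (K t y0), risom h &
  \forall y \near y0, E y -> forall S, framed (K^~ y) 0 1 S ->
    (forall m, S 0 m = tot i0 x0 m) -> forall m, S t m = tot i (K t y) (h m)].
suff : P 1 by [].
apply: (@segment_ind R P 0 1 _ 0 1); [|lra|lra|]; last first.
  exists i0, id; split; [by rewrite K0|exact: risom_id|].
  by apply: nearW => y Ey S _ S0 m; rewrite S0 K0.
move=> t t01; have Dt := (KP y0 Ey0 t t01).1.
have [i it] := chart_cover B Dt.
have [e e0 near_i] := near_K _ _ t01 (chart_open Dt it).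
exists e => // t1 t2 t101 t201 d1 d2 [j [h [jt1 hP near_h]]].
have it1 := nbhs_singleton near_i Ey0 _ t101 d1.
have [k kP near_k] := transition_tot (KP y0 Ey0 t1 t101).1 it1 jt1.
have [e' e'0 {}near_k] := near_K _ _ t101 near_k.
exists i, (k \o h); split.
- exact: (nbhs_singleton near_i Ey0 _ t201 d2).
- exact: risom_comp.
apply: filterS3 near_i near_h near_k => y iy hy ky Ey S SP S0 m.
apply: (framed_extend (KP y Ey) SP t101 t201) => [s s01|m'].
  rewrite ge_min le_max => sP; apply: iy => //.
  move: d1 d2; rewrite !ltr_norml => ? ?.
  by case/andP: sP => /orP[?|?] /orP[?|?]; lra.
by rewrite (hy Ey S SP S0) ky // subrr normr0.
Qed.

(* T x f: the isomorphism f is a value at x of a flat frame of the bundle, all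
   whose values at x agree up to sign. *)
Definition is_sign_trivialization (A : pzRingType) (X : topologicalType)
    (D : set X) (B : flat_bundle2 A D)
    (T : forall x : X, (rank2 A -> B x) -> Prop) : Prop :=
  [/\ forall x, D x -> exists f, T x f,
      forall x f, D x -> T x f -> risom f,
      forall x f, D x -> T x f -> T x (fun m => - f m),
      forall x f f', D x -> T x f -> T x f' ->
        (forall m, f' m = f m) \/ (forall m, f' m = - f m)
    & forall x0 i u, D x0 -> chart_dom i x0 ->
        exists m, \forall x \near within D (nbhs x0),
          exists2 f, T x f & f m = comb i x u].

(** * A flat frame over the unrolled direction bundle *)

Section FlatFrame.
Context (R : realType) (n : nat) (P : punctures R n) (A : pzRingType).

(** Over the disk this is a star-shaped covering space: the circle of directions is unrolled to the
    line of angles. *)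
Definition dir_cover (y : plane R * R) : plane R * plane R :=
  (y.1, unit_vec y.2).

Lemma dir_bundle_cover y : disk P y.1 -> dir_bundle P (dir_cover y).
Proof. by move=> ?; split=> //; exact: sqnorm_unit_vec. Qed.

(** The radial contraction of the covering, projected to the bundle: for fixed [y], a path from a
    common base point to [dir_cover y]. *)
Definition contraction (t : R) (y : plane R * R) : plane R * plane R :=
  ((t * y.1.1, t * y.1.2), unit_vec (t * y.2)).

Lemma contraction1 y : contraction 1 y = dir_cover y.
Proof. by case: y => -[x1 x2] a; rewrite /contraction /= !mul1r. Qed.

Lemma continuous_contraction :
  continuous (fun ty : R * (plane R * R) => contraction ty.1 ty.2).
Proof.
move=> ty.
have c1 : {for ty, continuous (fun ty : R * (plane R * R) => ty.1)}.
  exact: continuous_fst.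
have c2 : {for ty, continuous (fun ty : R * (plane R * R) => ty.2)}.
  exact: continuous_snd.
have c21 : {for ty, continuous (fun ty : R * (plane R * R) => ty.2.1)}.
  exact: continuous_comp c2 (@continuous_fst _ _ _).
have c22 : {for ty, continuous (fun ty : R * (plane R * R) => ty.2.2)}.
  exact: continuous_comp c2 (@continuous_snd _ _ _).
have c211 : {for ty, continuous (fun ty : R * (plane R * R) => ty.2.1.1)}.
  exact: continuous_comp c21 (@continuous_fst _ _ _).
have c212 : {for ty, continuous (fun ty : R * (plane R * R) => ty.2.1.2)}.
  exact: continuous_comp c21 (@continuous_snd _ _ _).
apply: (@continuous_pair _ _ _
  (fun ty : R * (plane R * R) => (ty.1 * ty.2.1.1, ty.1 * ty.2.1.2))
  (fun ty : R * (plane R * R) => unit_vec (ty.1 * ty.2.2))).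
  by apply: continuous_pair; exact: continuousM.
apply: (@continuous_comp _ _ _ (fun ty : R * (plane R * R) => ty.1 * ty.2.2)).
  exact: continuousM.
exact: continuous_unit_vec.
Qed.

Lemma cpath_contraction y : disk P y.1 ->
  cpath (dir_bundle P) (contraction^~ y) 0 1.
Proof.
move=> [y1 yP] t t01; split; last first.
  apply: (@continuous_comp _ _ _ (fun t : R => (t, y))
    (fun ty : R * (plane R * R) => contraction ty.1 ty.2)).
    by apply: continuous_pair; [exact: cvg_id|exact: cvg_cst].
  exact: continuous_contraction.
split; last exact: sqnorm_unit_vec.
(* The radial path reaches the boundary circle, where the punctures lie, at most at time 1, and its
   end is in the disk by hypothesis. *)
have [->|t1] := eqVneq t 1.
  by rewrite contraction1.
have {}t1 : t < 1 by rewrite lt_neqAle t1; lra.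
have s1 : sqnorm (contraction t y).1 < 1.
  have -> : sqnorm (contraction t y).1 = t ^+ 2 * sqnorm y.1.
    by rewrite /sqnorm /=; ring.
  have : 0 <= sqnorm y.1 by rewrite addr_ge0 ?sqr_ge0.
  by nra.
split; first exact: ltW.
by move=> p e; move: s1; rewrite e sqnorm_unit_vec ltxx.
Qed.

(** [F y] is obtained by parallel transport along the radial path to [y]; its flatness comes from
    [framed_family]. *)
Lemma flat_frame (B : flat_bundle2 A (dir_bundle P)) :
  exists F : plane R * R -> rank2 A -> total_space B,
    forall y0, disk P y0.1 -> exists i h,
      [/\ chart_dom i (dir_cover y0), risom h &
        \forall y \near y0, disk P y.1 ->
          forall m, F y m = tot i (dir_cover y) (h m)].
Proof.
pose x0 := contraction 0 (0, 0).
have K0 y : contraction 0 y = x0 by rewrite /x0 /contraction /= !mul0r.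
have D0 : dir_bundle P x0.
  split; last exact: sqnorm_unit_vec.
  rewrite /x0 /contraction /= !mul0r; split=> [|p e].
    by rewrite /sqnorm /= expr0n /= addr0 ler01.
  have := sqnorm_unit_vec (P p); rewrite -[unit_vec _]e /sqnorm /= expr0n /=.
  by lra.
have [i0 i0x0] := chart_cover B D0.
pose flat y S := framed (contraction^~ y) 0 1 S /\
  forall m, S 0 m = tot i0 x0 m.
(* Uniqueness of parallel frames makes the final value independent of [S]; off the disk an arbitrary
   default is taken. *)
have /choice [F FP] y : exists F : rank2 A -> total_space B,
    disk P y.1 -> forall S, flat y S -> forall m, F m = S 1 m.
  have [yD|nyD] := pselect (disk P y.1); last by exists (tot i0 x0).
  have c0 : chart_dom i0 (contraction 0 y) by rewrite K0.
  have [S SP S0] := framed_exists ler01 (cpath_contraction yD) c0.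
  exists (S 1) => _ S' [S'P S'0].
  apply: (framed_unique (cpath_contraction yD) SP S'P (t1 := 0)); try lra.
  by move=> m; rewrite S0 S'0 K0.
exists F => y0 y0D.
have [i [h [iy hP near_h]]] := framed_family
  (fun y (yD : [set y | disk P y.1] y) => cpath_contraction yD)
  (fun t _ => @continuous_contraction (t, y0)) (fun y _ => K0 y) i0x0 y0D.
exists i, h; split; [by rewrite -contraction1|by []|].
apply: filterS near_h => y near_h yD m.
have c0 : chart_dom i0 (contraction 0 y) by rewrite K0.
have [S SP S0] := framed_exists ler01 (cpath_contraction yD) c0.
have {}S0 m' : S 0 m' = tot i0 x0 m' by rewrite S0 K0.
by rewrite (FP y yD S) // -contraction1; exact: near_h.
Qed.

End FlatFrame.

(** * Descent of the flat frame, up to sign *)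

Section SignTrivialization.
Context (R : realType) (n : nat) (P : punctures R n) (A : pzRingType).
Context (L : twisted_local_system P A).

(** The isomorphisms attached to [x] are the values of [F] at all the angles that represent its
    direction; the twist makes them agree up to sign. *)
Lemma sign_trivialization :
  exists T : forall x : plane R * plane R, (rank2 A -> L x) -> Prop,
    is_sign_trivialization T.
Proof.
have [F FP] := flat_frame L.
have Ffib y : disk P y.1 -> exists2 f : rank2 A -> L (dir_cover y), risom f &
    forall m, F y m = in_fib _ (f m).
  move=> yD; have [i [h [iy hP /nbhs_singleton/(_ yD) e]]] := FP y yD.
  exists (comb i (dir_cover y) \o h); last exact: e.
  by apply: risom_comp => //; apply: risom_comb => //; exact: dir_bundle_cover.
pose G (x : plane R * plane R) (f : rank2 A -> L x) (a : R) :=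
  x.2 = unit_vec a /\ forall m, F (x.1, a) m = in_fib x (f m).
(* As [t] grows by one turn, the vector [F (x, a + t) m] is parallel along the fibre circle, so the
   holonomy changes its sign. *)
have turn x f a : dir_bundle P x -> G x f a ->
    G x (fun m => - f m) (a + 2 * pi).
  case: x f => x u f [/= xD _] [/= ua fE]; subst u.
  split=> /= [|m]; first by rewrite unit_vecD2pi.
  apply: (fiber_holonomy (s := fun t => F (x, a + t) m) xD); last first.
    by rewrite addr0.
  move=> t0 t0P; have [i [h [it hP near_h]]] := FP (x, a + t0) xD.
  exists i, (h m).1, (h m).2; split=> //.
  have ct : {for t0, continuous (fun t : R => (x, a + t))}.
    apply: continuous_pair; first exact: cvg_cst.
    by apply: cvgD; [exact: cvg_cst|exact: cvg_id].
  have near_t : nbhs t0 [set t | F (x, a + t) m =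
      tot i (x, unit_vec (a + t)) (h m)].
    by apply: (@filterS _ (nbhs t0) _ _ _ _ (ct _ near_h)) => t /= ->.
  by rewrite near_withinE; apply: filterS near_t.
exists (fun x f => exists a, G x f a); split.
- move=> [x u] [/= xD /unit_vec_surj [a ->]].
  by have [f fP fE] := Ffib (x, a) xD; exists f, a.
- move=> [x u] f [/= xD _] [a [/= ua fE]]; subst u.
  have [g gP gE] := Ffib (x, a) xD.
  suff -> : f = g by [].
  by apply/funext => m; apply: in_fib_inj; rewrite -fE gE.
- by move=> x f xD [a Ga]; exists (a + 2 * pi); exact: turn.
- move=> x f f' xD [a Ga] [a' Ga'].
  (* Two angles of one direction differ by full turns, each of which changes the sign of the
     frame. *)
  have [k] : exists k : nat, a' = a + (2 * pi) *+ k \/ a = a' + (2 * pi) *+ k.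
    by apply: unit_vec_inj; rewrite -Ga.1 Ga'.1.
  wlog : a a' f f' Ga Ga' / a' = a + (2 * pi) *+ k.
    move=> hw [e|e]; first by apply: (hw a a') => //; left.
    have := hw a' a f' f Ga' Ga e (or_introl e).
    by move=> [h|h]; [left|right] => m; rewrite h // opprK.
  move=> a'E _.
  have : G x f a' \/ G x (fun m => - f m) a'.
    rewrite a'E; elim: (k) => [|l [IH|IH]]; first by left; rewrite mulr0n addr0.
      by right; rewrite mulrSr addrA; exact: turn.
    left; rewrite mulrSr addrA; have := turn _ _ _ xD IH.
    by congr G; apply/funext => m; rewrite opprK.
  by move=> [[_ h]|[_ h]]; [left|right] => m; apply: in_fib_inj;
    rewrite -h Ga'.2.
- move=> [x0 u0] i u [/= x0D u01] i0; have [a ua] := unit_vec_surj u01.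
  subst u0.
  have [j [h [j0 hP near_h]]] := FP (x0, a) x0D.
  have D0 : dir_bundle P (x0, unit_vec a) by [].
  have [k kP near_k] := transition D0 j0 i0.
  have [m mE] := risom_surj hP (k u); exists m.
  (* [local_angle] lifts nearby directions continuously to the covering, which turns [F] into a flat
     frame on the bundle near the given point. *)
  have cl : {for (x0, unit_vec a), continuous
      (fun x : plane R * plane R => (x.1, local_angle a x.2))}.
    apply: continuous_pair; first exact: continuous_fst.
    apply: (@continuous_comp _ _ _ snd (local_angle a)).
      exact: continuous_snd.
    exact: continuous_local_angle.
  have near_l : \forall x \near (x0, unit_vec a),
      sqnorm x.2 = 1 -> unit_vec (local_angle a x.2) = x.2.
    exact: (@continuous_snd _ _ (x0, unit_vec a) _
      (near_unit_vec_local_angle a)).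
  have {}near_h : \forall x \near (x0, unit_vec a), disk P x.1 ->
      forall m, F (x.1, local_angle a x.2) m =
        tot j (dir_cover (x.1, local_angle a x.2)) (h m).
    by rewrite -{1}(local_angle_id a) in near_h; exact: (cl _ near_h).
  move: near_k; rewrite !near_withinE => near_k.
  apply: filterS3 near_k near_l near_h => -[x v] /= kE lE hE [/= xD v1].
  exists (comb j (x, v) \o h); last by rewrite /= mE -kE.
  exists (local_angle a v); split=> /= [|m']; first by rewrite lE.
  by rewrite hE // /dir_cover /= lE.
Qed.

End SignTrivialization.

(** * Coordinates up to sign of parallel sections *)

Section SignCoordinates.
Context (R : realType) (A : pzRingType) (X : topologicalType) (D : set X).
Context (B : flat_bundle2 A D) (T : forall x : X, (rank2 A -> B x) -> Prop).
Context (TP : is_sign_trivialization T).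

Definition has_coord (q : total_space B) (m : rank2 A) : Prop :=
  exists2 f, T f & projT2 q = f m.

Lemma has_coord_rep x (z : B x) m : D x -> has_coord (in_fib x z) m ->
  exists f, [/\ T f, risom f & z = f m].
Proof.
by case: TP => _ Tiso _ _ _ Dx [f Tf /= zE]; exists f; split=> //; exact: Tiso.
Qed.

Lemma has_coord_at x (z : B x) m f : D x -> T f -> has_coord (in_fib x z) m ->
  z = f m \/ z = f (- m).
Proof.
case: TP => _ Tiso _ Tu _ Dx Tf [g Tg /= ->].
rewrite (risomN (Tiso _ _ Dx Tf)).
by case: (Tu _ _ _ Dx Tf Tg) => ->; [left|right].
Qed.

Lemma has_coordN q m : D (projT1 q) -> has_coord q m -> has_coord q (- m).
Proof.
case: TP => _ Tiso TN _ _ Dq [f Tf qE].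
exists (fun m => - f m); first exact: TN.
by rewrite (risomN (Tiso _ _ Dq Tf)) opprK.
Qed.

Lemma has_coord_line x (z : B x) m f : D x -> T f ->
  has_coord (in_fib x z) m -> rline z = rline (f m).
Proof.
move=> Dx Tf /(has_coord_at Dx Tf)[->//|->].
by case: TP => _ Tiso _ _ _; rewrite (risomN (Tiso _ _ Dx Tf)) rline_opp.
Qed.

Lemma near_has_coord (c : R -> X) a b t0 i u : cpath D c a b ->
  a <= t0 <= b -> chart_dom i (c t0) ->
  exists m, exists2 e, 0 < e & forall t, a <= t <= b -> `|t - t0| < e ->
    has_coord (tot i (c t) u) m.
Proof.
case: TP => _ _ _ _ Tloc cP t0ab it.
have [m near_m] := Tloc _ _ u (cP t0 t0ab).1 it; exists m.
have [e e0 he] := cpath_near cP t0ab near_m; exists e => // t tab te.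
by have [f Tf fE] := he t tab te; exists f.
Qed.

(** A parallel section is locally a chart section with constant coefficients, so it has a fixed
    coordinate [m0] there. Coordinates being unique up to sign, [m] is [m0] or [- m0], and both
    persist. *)
Lemma parallel_has_coord (c : R -> X) a b s m t1 t2 : cpath D c a b ->
  parallel c a b s -> a <= t1 <= b -> a <= t2 <= b ->
  has_coord (s t1) m -> has_coord (s t2) m.
Proof.
move=> cP sP; apply: (segment_ind (P := fun t => has_coord (s t) m)) => t tab.
have [i [u1 [u2 [it /near_segment[e e0 sE]]]]] := sP t tab.
have he t' : a <= t' <= b -> `|t' - t| < e -> s t' = tot i (c t') (u1, u2).
  exact: sE.
have [m0 [e' e'0 he']] := near_has_coord (u1, u2) cP tab it.
exists (Num.min e e'); first by rewrite lt_min e0.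
move=> s1 s2 s1ab s2ab; rewrite !lt_min => /andP[d1 d1'] /andP[d2 d2'].
have D1 := (cP _ s1ab).1; have D2 := (cP _ s2ab).1.
rewrite !he // => c1; have c2 := he' _ s2ab d2'.
have [f [Tf fP fE]] := has_coord_rep D1 (he' _ s1ab d1').
case: (has_coord_at D1 Tf c1); rewrite fE => /(risom_inj fP) mE.
  by rewrite -mE.
rewrite -[m]opprK -mE.
exact: (has_coordN (q := tot i (c s2) (u1, u2)) D2 c2).
Qed.

(** Only the class of [w] modulo [v] is parallel, so what propagates is that this class contains a
    vector [w'] of coordinate [W]. *)
Lemma parallel_mod_has_coord (c : R -> X) a b (v w : forall t, B (c t))
    V W t1 t2 :
  cpath D c a b -> (forall t, a <= t <= b -> has_coord (in_fib _ (v t)) V) ->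
  parallel_mod a b v w -> a <= t1 <= b -> a <= t2 <= b ->
  (exists2 w', rline (v t1) (w t1 - w') & has_coord (in_fib _ w') W) ->
  exists2 w', rline (v t2) (w t2 - w') & has_coord (in_fib _ w') W.
Proof.
move=> cP vV wP.
apply: (segment_ind (P := fun t => exists2 w', rline (v t) (w t - w')
  & has_coord (in_fib _ w') W)) => t tab.
have [i [u1 [u2 [it /near_segment[e e0 wE]]]]] := wP t tab.
have he t' : a <= t' <= b -> `|t' - t| < e ->
    rline (v t') (w t' - comb i (c t') (u1, u2)).
  exact: wE.
have [m0 [e' e'0 he']] := near_has_coord (u1, u2) cP tab it.
exists (Num.min e e'); first by rewrite lt_min e0.
move=> s1 s2 s1ab s2ab; rewrite !lt_min => /andP[d1 d1'] /andP[d2 d2'].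
have D1 := (cP _ s1ab).1; have D2 := (cP _ s2ab).1.
have l1 := he _ s1ab d1; have l2 := he _ s2ab d2.
move=> [w' w'l w'W].
have [f [Tf fP fE]] := has_coord_rep D1 (he' _ s1ab d1').
have [g [Tg gP gE]] := has_coord_rep D2 (he' _ s2ab d2').
(* Once the frame [f] is fixed, [W'] is [W] with the sign for which it is congruent modulo [V] to
   the coordinate [m0] of the chart section. *)
have [W' W'E W'l] : exists2 W', W' = W \/ W' = - W & rline V (W' - m0).
  have W'l W' : w' = f W' -> rline V (W' - m0).
    move=> w'E; apply/(risom_rline fP).
    rewrite -(has_coord_line D1 Tf (vV _ s1ab)) (risomB fP) -fE -w'E.
    have -> : w' - comb i (c s1) (u1, u2) =
      (w s1 - comb i (c s1) (u1, u2)) - (w s1 - w').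
      by rewrite opprB [RHS]addrC addrA subrK.
    by apply: rlineD => //; exact: rlineN.
  by case: (has_coord_at D1 Tf w'W) => /W'l; [exists W|exists (- W)]; auto.
exists (g W').
  have -> : w s2 - g W' = (w s2 - comb i (c s2) (u1, u2)) - g (W' - m0).
    by rewrite (risomB gP) opprB -gE addrA subrK.
  apply: rlineD => //; apply: rlineN.
  by rewrite (has_coord_line D2 Tg (vV _ s2ab)); apply/(risom_rline gP).
have cW' : has_coord (in_fib (c s2) (g W')) W' by exists g.
case: W'E cW' => -> // cW'.
have := has_coordN (q := in_fib (c s2) (g (- W))) D2 cW'.
by rewrite opprK.
Qed.

End SignCoordinates.

(** * Tangent lifts as paths in the direction bundle *)

Section TangentLifts.
Context (R : realType).
Implicit Types (v : plane R) (c : R -> plane R).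

Lemma sqnorm_gt0 v : v <> (0, 0) -> 0 < sqnorm v.
Proof.
case: v => x y v0; rewrite lt0r addr_ge0 ?sqr_ge0 // andbT.
apply/eqP => /eqP; rewrite paddr_eq0 ?sqr_ge0 // !sqrf_eq0 /=.
by move=> /andP[/eqP x0 /eqP y0]; apply: v0; rewrite x0 y0.
Qed.

Lemma sqnorm_direction v : v <> (0, 0) -> sqnorm (direction v) = 1.
Proof.
move=> /sqnorm_gt0 v0.
have -> : sqnorm (direction v) = (Num.sqrt (sqnorm v)) ^- 2 * sqnorm v.
  by rewrite /direction /sqnorm /= !exprMn !exprVn mulrDr.
by rewrite sqr_sqrtr ?ltW // mulVf // gt_eqF.
Qed.

Lemma continuous_tangent_lift c t : simple_smooth_arc c -> 0 <= t <= 1 ->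
  {for t, continuous (tangent_lift c)}.
Proof.
move=> [cs cv _] t01.
(* Derivability of the components and of their first derivatives gives continuity of the arc and of
   its velocity, which can be normalized as it does not vanish. *)
have [/derivable1_diffP/differentiable_continuous c1
  /derivable1_diffP/differentiable_continuous c2] := cs 0%N t.
have [/derivable1_diffP/differentiable_continuous v1
  /derivable1_diffP/differentiable_continuous v2] := cs 1%N t.
have n0 := sqnorm_gt0 (cv t t01).
have cn : {for t, continuous (fun s => (Num.sqrt (sqnorm (velocity c s)))^-1)}.
  apply: continuousV; first by rewrite gt_eqF // sqrtr_gt0.
  apply: (@continuous_comp _ _ _ (fun s => sqnorm (velocity c s)) Num.sqrt).
    have -> : (fun s => sqnorm (velocity c s)) = (fun s =>
        (velocity c s).1 * (velocity c s).1 +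
        (velocity c s).2 * (velocity c s).2).
      by apply/funext => s; rewrite /sqnorm !expr2.
    by apply: continuousD; exact: continuousM.
  exact: sqrt_continuous.
apply: (@continuous_pair _ _ _ c (fun s => direction (velocity c s))).
  have -> : c = fun s => ((c s).1, (c s).2).
    by apply/funext => s; case: (c s).
  exact: continuous_pair.
apply: (@continuous_pair _ _ _
  (fun s => (Num.sqrt (sqnorm (velocity c s)))^-1 * (velocity c s).1)
  (fun s => (Num.sqrt (sqnorm (velocity c s)))^-1 * (velocity c s).2)).
  exact: continuousM.
exact: continuousM.
Qed.

Lemma cpath_tangent_lift n (P : punctures R n) c a b : simple_smooth_arc c ->
  0 <= a -> b <= 1 -> (forall t, a <= t <= b -> disk P (c t)) ->
  cpath (dir_bundle P) (tangent_lift c) a b.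
Proof.
move=> cs a0 b1 cD t tab; have t01 : 0 <= t <= 1 by lra.
split; last exact: continuous_tangent_lift.
by split; [exact: cD|apply: sqnorm_direction; case: cs => _ /(_ t t01)].
Qed.

Lemma disk_boundary n (P : punctures R n) a :
  (forall p, P p - 2 * pi < a < P p \/ P p < a < P p + 2 * pi) ->
  disk P (unit_vec a).
Proof.
move=> aP; split=> [|p e]; first by rewrite sqnorm_unit_vec.
have [h|h] := aP p.
  by have := unit_vec_inj_turn e; lra.
by have := unit_vec_inj_turn (esym e); lra.
Qed.

(** Only the ends of the arc reach the boundary circle, and their cyclic order keeps them away from
    all punctures. *)
Lemma disk_beta n (P : punctures R n) (b : puncture_arcs P) p t :
  0 <= t <= 1 -> disk P (b p t).
Proof.
move=> t01.
have [t0|t0] := eqVneq t 0; last first.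
have [t1|t1] := eqVneq t 1; last first.
- have s1 : sqnorm (b p t) < 1.
    by apply: beta_inside; move/eqP: t0; move/eqP: t1; lra.
  by split=> [|q e]; [exact: ltW|move: s1; rewrite e sqnorm_unit_vec ltxx].
- rewrite t1 beta_end; apply: disk_boundary => q.
  have := beta_turn b p p; have := beta_around b p; have := beta_around b q.
  have [pq|qp|/val_inj ->] := ltngtP p q; last by lra.
    by have := beta_turn b q p; have := beta_incr b pq; lra.
  by have := beta_turn b p q; have := beta_incr b qp; lra.
- rewrite t0 beta_start; apply: disk_boundary => q.
  have := beta_turn b p p; have := beta_around b p; have := beta_around b q.
  have [pq|qp|/val_inj ->] := ltngtP p q; last by lra.
    by have := beta_turn b q p; have := beta_incr b pq; lra.
  by have := beta_turn b p q; have := beta_incr b qp; lra.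
Qed.

End TangentLifts.

(** * The decoration as vectors of A^2 *)

Section DecorationCoordinates.
Context (R : realType) (n : nat) (P : punctures R n) (A : pzRingType).
Context (b : puncture_arcs P) (L : twisted_local_system P A).
Context (d : decoration b L).
Context (T : forall x, (rank2 A -> L x) -> Prop).
Context (TP : is_sign_trivialization T).

Lemma cpath_beta p : cpath (dir_bundle P) (tangent_lift (b p)) 0 1.
Proof.
by apply: cpath_tangent_lift => //; [exact: beta_arc|exact: disk_beta].
Qed.

Lemma cpath_bent p q (g : bent_arc b p q) :
  cpath (dir_bundle P) (tangent_lift g) (exit_time g) (entry_time g).
Proof.
have [e0 ee e1] := bent_times g.
apply: cpath_tangent_lift; [exact: bent_arcP|exact: ltW|exact: ltW|].
by move=> t tP; apply: bent_disk; lra.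
Qed.

(** Both vectors are read off at the start of the arc in one frame; parallelism then keeps them as
    coordinates along the whole arc. *)
Lemma decoration_coord p : exists VW : rank2 A * rank2 A,
  [/\ is_regular VW.1, forall z, exists! a : A, rline VW.1 (z - VW.2 *r a),
      forall t, 0 <= t <= 1 -> has_coord T (in_fib _ (deco_v d p t)) VW.1
    & forall t, 0 <= t <= 1 -> exists2 w', rline (deco_v d p t)
        (deco_w d p t - w') & has_coord T (in_fib _ w') VW.2].
Proof.
have h0 : 0 <= (0 : R) <= 1 by rewrite lexx ler01.
have D0 := (cpath_beta p h0).1.
case: (TP) => Tex Tiso _ _ _; have [f Tf] := Tex _ D0.
have fP := Tiso _ _ D0 Tf.
have [V VE] := risom_surj fP (deco_v d p 0).
have [W WE] := risom_surj fP (deco_w d p 0).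
have vV t : 0 <= t <= 1 -> has_coord T (in_fib _ (deco_v d p t)) V.
  move=> t01; apply: (parallel_has_coord TP (cpath_beta p)
    (deco_v_parallel d p) h0 t01).
  by exists f.
exists (V, W); split=> //=.
- by apply: (risom_regular fP); rewrite VE; exact: deco_v_regular.
- move=> z; case: (fP) => _ fZ _.
  have e a : rline V (z - W *r a) <->
      rline (deco_v d p 0) (f z - deco_w d p 0 *r a).
    by rewrite -VE -WE -fZ -(risomB fP); split=> /(risom_rline fP).
  have [a [/e la U]] := deco_w_basis d h0 (f z).
  by exists a; split=> // a' /e /U.
- move=> t t01; apply: (parallel_mod_has_coord TP (cpath_beta p) vV
    (deco_w_parallel d p) h0 t01).
  exists (deco_w d p 0); last by exists f.
  by rewrite subrr; exists 0; rewrite rscale0r.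
Qed.

Section Arc.
Context (V W : 'I_n -> rank2 A).
Context (vV : forall p t, 0 <= t <= 1 ->
  has_coord T (in_fib _ (deco_v d p t)) (V p)).
Context (wW : forall p t, 0 <= t <= 1 -> exists2 w', rline (deco_v d p t)
  (deco_w d p t - w') & has_coord T (in_fib _ w') (W p)).
Context (p q : 'I_n) (g : bent_arc b p q).

(** The lifts of the arc and of [b p] meet at the exit point, so the transported section starts with
    coordinate [V p], which parallelism preserves. *)
Lemma transported_v_coord z : transported_v d (g := g) z ->
  has_coord T (in_fib _ z) (V p).
Proof.
move=> [s [sP s0 s1]]; have [_ /ltW ee _] := bent_times g.
have c0 : has_coord T (s (exit_time g)) (V p).
  by rewrite s0; exact: vV (exit_posP g).
have h0 : exit_time g <= exit_time g <= entry_time g by rewrite lexx ee.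
have h1 : exit_time g <= entry_time g <= entry_time g by rewrite lexx ee.
have := parallel_has_coord TP (cpath_bent (g := g)) sP h0 h1 c0.
by rewrite s1.
Qed.

Lemma transverse_along_coord : transverse_along d g ->
  transverse_lines (rline (V p)) (rline (V q)).
Proof.
move=> [z /transported_v_coord zV].
have D0 := (cpath_beta q (entry_posP g)).1.
have [f [Tf fP zE]] := has_coord_rep TP D0 zV.
rewrite (has_coord_line TP D0 Tf (vV q (entry_posP g))) zE.
exact: risom_transverse.
Qed.

Lemma A_coordinate_coord : transverse_along d g ->
  rline (V q) (V p - W q *r A_coordinate d g) \/
  rline (V q) (V p + W q *r A_coordinate d g).
Proof.
move=> [z0 z0P _].
(* The basis property of [deco_w] provides a coordinate, so [A_coordinate] satisfies its defining
   condition rather than falling back on the default 0. *)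
have [z /transported_v_coord zV] : is_A_coordinate d g (A_coordinate d g).
  have [a [la _]] := deco_w_basis d (entry_posP g) z0.
  by apply: (@xgetPex _ 0 [set a | is_A_coordinate d g a]); exists a, z0.
set a := A_coordinate d g.
have D0 := (cpath_beta q (entry_posP g)).1.
(* In this frame the transported vector has coordinate exactly [V p]; the remaining sign is that of
   the representative [w'] of [deco_w]. *)
have [f [Tf fP zE]] := has_coord_rep TP D0 zV.
have [w' + w'W] := wW q (entry_posP g).
rewrite (has_coord_line TP D0 Tf (vV q (entry_posP g))) zE => lw la.
have {lw}la : rline (f (V q)) (f (V p) - w' *r a).
  have -> : f (V p) - w' *r a =
    (f (V p) - deco_w d q (entry_pos g) *r a) +
    (deco_w d q (entry_pos g) - w') *r a.
    by rewrite rscaleDl rscaleNl addrA subrK.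
  by apply: rlineD => //; exact: rlineZ.
case: (fP) => _ fZ _.
case: (has_coord_at TP D0 Tf w'W) la => ->; rewrite -fZ -(risomB fP).
  by move=> /(risom_rline fP); left.
by rewrite rscaleNl opprK => /(risom_rline fP); right.
Qed.

End Arc.
End DecorationCoordinates.

(** * Reduction of the geometric statement to vectors of A^2 *)

Theorem theorem4p6 (R : realType) (A : pzRingType) (n : nat) (hn : (3 <= n)%N)
    (P : punctures R n) (b : puncture_arcs P) (g : arc_system b)
    (i j : 'I_n) (hji : j != i)
    (T : ideal_triangulation n)
    (L : twisted_local_system P A) (d : decoration b L)
    (hT : forall (p q : 'I_n) (hpq : p != q),
      T p q -> transverse_along d (g p q hpq))
    (hij : transverse_along d (g j i hji)) :
  is_nc_laurent
    [set a | exists (p q : 'I_n) (hpq : p != q),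
      T p q /\ a = A_coordinate d (g p q hpq)]
    (A_coordinate d (g j i hji)).
Proof.
have [F FP] := sign_trivialization L.
have /choice [VW VWP] := decoration_coord d FP.
have vV p : forall t, _ := let: And4 _ _ h _ := VWP p in h.
have wW p : forall t, _ := let: And4 _ _ _ h := VWP p in h.
have T_neq p q : T p q -> p != q.
  by apply: contraTneq => ->; rewrite edge_irr.
(* The arc runs from [j] to [i], so its coordinate is, up to sign, the form at [i] evaluated on the
   vector at [j]. *)
apply: (@laurent_coordinates _ _ _ T (fun p => (VW p).1)
  (fun p => (VW p).2) _ _ _ _ _ i j).
- by move=> p; case: (VWP p).
- by move=> p; case: (VWP p).
- move=> p q Tpq.
  apply: (transverse_along_coord FP vV (g := g p q (T_neq _ _ Tpq))).
  exact: hT.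
- move=> p q Tpq; exists (A_coordinate d (g p q (T_neq _ _ Tpq))).
    by exists p, q, (T_neq _ _ Tpq).
  by apply: (A_coordinate_coord FP vV wW); exact: hT.
- exact: (A_coordinate_coord FP vV wW hij).
Qed.
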